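(* Let $R$ and $S$ be associative rings and let ${}_SC_R$ be a faithfully semidualizing $(S,R)$-bimodule. The classes $\mathcal{A}_C(R)$ and $\mathcal{B}_C(S)$ have the property that if two of the three modules in a short exact sequence (of $R$-modules, respectively $S$-modules) are in the class, then so is the third.
   Context: Rings are associative with unity (not necessarily commutative or noetherian). Modules are unital left modules; right $R$-modules are identified with left $R^{\mathrm{op}}$-modules. An $(S,R)$-bimodule $C={}_SC_R$ is semidualizing if: (a1) ${}_SC$ admits a degreewise finite $S$-projective resolution (a projective resolution by finitely generated projectives); (a2) $C_R$ admits a degreewise finite $R^{\mathrm{op}}$-projective resolution; (b1) the homothety map $S\to\operatorname{Hom}_{R^{\mathrm{op}}}(C,C)$, $s\mapsto(x\mapsto sx)$, is an isomorphism; (b2) the homothety map $R\to\operatorname{Hom}_S(C,C)$, $r\mapsto(x\mapsto xr)$, is an isomorphism; (c1) $\operatorname{Ext}_S^{i}(C,C)=0$ for all $i\geq1$; (c2) $\operatorname{Ext}_{R^{\mathrm{op}}}^{i}(C,C)=0$ for all $i\geq 1$. It is faithfully semidualizing if moreover, for all left $S$-modules $N$ and right $R$-modules $M$: $\operatorname{Hom}_S(C,N)=0$ implies $N=0$, and $\operatorname{Hom}_{R^{\mathrm{op}}}(C,M)=0$ implies $M=0$. The Auslander class $\mathcal{A}_C(R)$ consists of all $R$-modules $M$ with (A1) $\operatorname{Tor}^R_i(C,M)=0$ for all $i\ge1$; (A2) $\operatorname{Ext}_S^i(C,C\otimes_RM)=0$ for all $i\ge1$; (A3) the natural map $\mu_M\colon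 M\to\operatorname{Hom}_S(C,C\otimes_RM)$, $m\mapsto(c\mapsto c\otimes m)$, is an isomorphism. The Bass class $\mathcal{B}_C(S)$ consists of all $S$-modules $N$ with (B1) $\operatorname{Ext}_S^i(C,N)=0$ for all $i\ge1$; (B2) $\operatorname{Tor}_i^R(C,\operatorname{Hom}_S(C,N))=0$ for all $i\ge1$; (B3) the natural evaluation map $\nu_N\colon C\otimes_R\operatorname{Hom}_S(C,N)\to N$, $c\otimes f\mapsto f(c)$, is an isomorphism. *)

(* Defs.v *)
From HB Require Import structures.
From mathcomp Require Import all_boot all_order all_algebra.
From mathcomp Require Import finmap all_classical.

Set Implicit Arguments.
Unset Strict Implicit.
Unset Printing Implicit Defensive.

Import GRing.Theory.
Local Open Scope ring_scope.

(* Rings are [pzRingType]s (the zero ring is allowed), modules are left modules,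
   and a right R-module is an [lmodType R^c].  Every [lmodType] carries a
   choice structure; classically this is no restriction on the module. *)

Definition trivial_module (V : zmodType) : Prop := forall x : V, x = 0.

Definition exact_at (U V W : zmodType) (f : U -> V) (g : V -> W) : Prop :=
  forall y : V, g y = 0 <-> exists x : U, f x = y.

Definition short_exact (R : pzRingType) (M' M M'' : lmodType R)
    (f : {linear M' -> M}) (g : {linear M -> M''}) : Prop :=
  [/\ injective f, exact_at f g & forall z : M'', exists y : M, g y = z].

Definition ker_pred (U V : zmodType) (f : {additive U -> V}) (x : U) : bool :=
  f x == 0.

Section Kernel.
Variables (U V : zmodType) (f : {additive U -> V}).

Record kernel := Kernel { kernel_val : U; kernel_valP : ker_pred f kernel_val }.

HB.instance Definition _ := [isSub for kernel_val].
HB.instance Definition _ := [Choice of kernel by <:].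

Fact ker_zmod_closed : zmod_closed (ker_pred f).
Proof.
split=> [|x y]; first exact/eqP/raddf0.
by move=> /eqP fx /eqP fy; apply/eqP; rewrite raddfB fx fy subr0.
Qed.
HB.instance Definition _ :=
  GRing.isZmodClosed.Build U (ker_pred f) ker_zmod_closed.
HB.instance Definition _ := [SubChoice_isSubZmodule of kernel by <:].
End Kernel.

Section LinearKernel.
Variables (R : pzRingType) (U V : lmodType R) (f : {linear U -> V}).

Fact ker_scaler_closed : GRing.scaler_closed (ker_pred f).
Proof.
move=> a x /eqP fx; apply/eqP.
have /= -> : f (a *: x) = a *: f x by rewrite linearZ.
by rewrite fx scaler0.
Qed.
HB.instance Definition _ :=
  GRing.isScaleClosed.Build R U (ker_pred f) ker_scaler_closed.
HB.instance Definition _ := [SubZmodule_isSubLmodule of kernel f by <:].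
End LinearKernel.

Section Homology.
Variables (U V W : zmodType) (f : {additive U -> V}) (g : {additive V -> W}).

Definition boundary : {pred kernel g} := fun z => `[< exists x, f x = val z >].

Fact boundary_zmod_closed : zmod_closed boundary.
Proof.
split=> [|y z /asboolP[a ay] /asboolP[b bz]]; apply/asboolP.
  by exists 0; rewrite raddf0.
by exists (a - b); rewrite raddfB ay bz.
Qed.
HB.instance Definition _ :=
  GRing.isZmodClosed.Build (kernel g) boundary boundary_zmod_closed.

Definition homology : zmodType := Quotient.quot boundary.
End Homology.

(* Free module on a set X: finitely supported functions X -> R. *)

Section Free.
Variables (R : pzRingType) (X : choiceType).

Definition fin_supp (a : X -> R^o) : bool :=
  `[< finite_set [set x | a x != 0] >].

Record free := Free { free_val : X -> R^o; free_valP : fin_supp free_val }.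

HB.instance Definition _ := [isSub for free_val].
HB.instance Definition _ := [Choice of free by <:].

Fact fin_supp_submod_closed : submod_closed fin_supp.
Proof.
split=> [|r a b /asboolP sa /asboolP sb]; apply/asboolP.
  by apply: (sub_finite_set _ (finite_set0 X)) => x /=; rewrite eqxx.
have sab : finite_set ([set x | a x != 0] `|` [set x | b x != 0])%classic.
  by rewrite finite_setU.
apply: sub_finite_set sab => x /=.
have [ax0|] := eqVneq (a x) 0; last by left.
have [bx0|] := eqVneq (b x) 0; last by right.
have -> : (r *: a + b) x = r *: a x + b x by [].
by rewrite ax0 bx0 scaler0 addr0 eqxx.
Qed.
HB.instance Definition _ :=
  GRing.isSubmodClosed.Build R (X -> R^o) fin_supp fin_supp_submod_closed.
HB.instance Definition _ := [SubChoice_isSubLmodule of free by <:].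

Fact basis_subproof (x : X) : fin_supp (fun y => (y == x)%:R).
Proof.
apply/asboolP/(sub_finite_set _ (finite_set1 x)) => y /=.
by have [->|] := eqVneq y x; rewrite ?eqxx.
Qed.
Definition basis (x : X) : free := Free (basis_subproof x).

Lemma free_supp (a : free) :
  exists A : {fset X}, forall x, x \notin A -> free_val a x = 0.
Proof.
have /asboolP sa := free_valP a; exists (fset_set [set x | free_val a x != 0]).
move=> x; rewrite in_fset_set // => /negP; apply: contra_notP => /eqP.
by rewrite inE.
Qed.

Section Lift.
Variables (M : lmodType R) (phi : X -> M).

Definition free_lift_fun (a : free) : M :=
  \sum_(x \in [set: X]) (free_val a x : R) *: phi x.

Lemma free_lift_funE (a : free) (A : {fset X}) :
  (forall x, x \notin A -> free_val a x = 0) ->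
  free_lift_fun a = \sum_(x <- A) (free_val a x : R) *: phi x.
Proof. by move=> aA; apply: fsbigTE => x /aA ->; rewrite scale0r. Qed.

Fact free_lift_is_linear : linear free_lift_fun.
Proof.
move=> r a b; have [A aA] := free_supp a; have [B bB] := free_supp b.
have rabE x : free_val (r *: a + b) x = r * free_val a x + free_val b x by [].
have aAB x : x \notin (A `|` B)%fset -> free_val a x = 0.
  by rewrite in_fsetU negb_or => /andP[/aA].
have bAB x : x \notin (A `|` B)%fset -> free_val b x = 0.
  by rewrite in_fsetU negb_or => /andP[_ /bB].
rewrite !(@free_lift_funE _ (A `|` B)%fset) // => [|x xA]; last first.
  by rewrite [LHS]rabE aAB // bAB // mulr0 addr0.
rewrite scaler_sumr -big_split; apply: eq_bigr => x _.
by rewrite scalerA /= -scalerDl; congr (_ *: _).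
Qed.
HB.instance Definition _ :=
  GRing.isLinear.Build R free M *:%R free_lift_fun free_lift_is_linear.
Definition free_lift : {linear free -> M} := free_lift_fun.

Lemma free_lift_basis (x : X) : free_lift (basis x) = phi x.
Proof.
rewrite [LHS](@free_lift_funE _ [fset x]%fset) => [|y].
  by rewrite big_seq_fset1 /= eqxx scale1r.
by rewrite in_fset1 /= => /negPf->.
Qed.
End Lift.

Lemma free_basisE (a : free) : a = free_lift basis a.
Proof.
have [A aA] := free_supp a; apply: val_inj; apply/funext => y.
rewrite [free_lift _ _](@free_lift_funE _ _ _ A) //.
rewrite raddf_sum /= fct_sumE.
have termE x : (free_val a x *: (fun z => (z == x)%:R : R^o)) y =
    (free_val a x : R) * (y == x)%:R by [].
rewrite (eq_bigr _ (fun x _ => termE x)).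
have [yA|yA] := boolP (y \in A); last first.
  rewrite aA // big_seq big1 // => x xA.
  by rewrite (_ : (y == x) = false) ?mulr0 //; apply: contraNF yA => /eqP ->.
rewrite (bigD1_seq y) ?fset_uniq //= eqxx mulr1 big1 ?addr0 // => x.
by rewrite eq_sym => /negPf ->; rewrite mulr0.
Qed.

Lemma free_additive_ext (V : zmodType) (f g : {additive free -> V}) :
  (forall r x, f (r *: basis x) = g (r *: basis x)) -> f =1 g.
Proof.
move=> fg a; rewrite [a]free_basisE /= /free_lift_fun !raddf_sum /=.
by apply: eq_bigr => x _; rewrite fg.
Qed.
End Free.

Section Tensor.
Variables (R : pzRingType) (X : lmodType R^c) (M : lmodType R).

(* [(r : R^c) *: x] is x r. *)
Inductive tensor_rel : free int (X * M)%type -> Prop :=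
| TensorDl x x' m :
    tensor_rel (basis int (x + x', m) - basis int (x, m) - basis int (x', m))
| TensorDr x m m' :
    tensor_rel (basis int (x, m + m') - basis int (x, m) - basis int (x, m'))
| TensorM x (r : R) m :
    tensor_rel (basis int ((r : R^c) *: x, m) - basis int (x, r *: m)).

Inductive tensor_span : free int (X * M)%type -> Prop :=
| TensorSpanRel z : tensor_rel z -> tensor_span z
| TensorSpan0 : tensor_span 0
| TensorSpanB y z : tensor_span y -> tensor_span z -> tensor_span (y - z).

Definition tensor_null : {pred free int (X * M)%type} :=
  fun z => `[< tensor_span z >].

Fact tensor_null_zmod_closed : zmod_closed tensor_null.
Proof.
split=> [|y z /asboolP sy /asboolP sz]; apply/asboolP; first exact: TensorSpan0.
exact: TensorSpanB.
Qed.
HB.instance Definition _ := GRing.isZmodClosed.Build (free int (X * M)%type)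
  tensor_null tensor_null_zmod_closed.

Definition tensor : Type := Quotient.quot tensor_null.
HB.instance Definition _ := GRing.Zmodule.on tensor.

Definition tensor_proj (z : free int (X * M)%type) : tensor :=
  \pi_(Quotient.quot tensor_null)%qT z.

Fact tensor_proj_is_zmod_morphism : zmod_morphism tensor_proj.
Proof. by move=> y z; rewrite /tensor_proj raddfB. Qed.
HB.instance Definition _ := GRing.isZmodMorphism.Build
  (free int (X * M)%type) tensor tensor_proj tensor_proj_is_zmod_morphism.

Lemma tensor_proj_surj (z : tensor) : exists a, z = tensor_proj a.
Proof.
by exists (repr (z : Quotient.quot tensor_null)); rewrite /tensor_proj reprK.
Qed.

Lemma tensor_proj_eq (y z : free int (X * M)%type) :
  tensor_proj y = tensor_proj z <-> tensor_span (y - z).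
Proof.
split=> [/eqP|yz]; last by apply/eqP; rewrite -Quotient.idealrBE; apply/asboolP.
by rewrite -Quotient.idealrBE => /asboolP.
Qed.

Definition tens (x : X) (m : M) : tensor := tensor_proj (basis int (x, m)).

Lemma tensDl x x' m : tens (x + x') m = tens x m + tens x' m.
Proof.
rewrite /tens -raddfD; apply/tensor_proj_eq; rewrite opprD addrA.
exact/TensorSpanRel/TensorDl.
Qed.

Lemma tensDr x m m' : tens x (m + m') = tens x m + tens x m'.
Proof.
rewrite /tens -raddfD; apply/tensor_proj_eq; rewrite opprD addrA.
exact/TensorSpanRel/TensorDr.
Qed.

Lemma tensM x (r : R) m : tens ((r : R^c) *: x) m = tens x (r *: m).
Proof. exact/tensor_proj_eq/TensorSpanRel/TensorM. Qed.

Lemma tensor_ext (V : zmodType) (f g : {additive tensor -> V}) :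
  (forall x m, f (tens x m) = g (tens x m)) -> f =1 g.
Proof.
move=> fg z; have [a ->] := tensor_proj_surj z.
apply: (@free_additive_ext _ _ _ (f \o tensor_proj) (g \o tensor_proj)).
move=> r [x m].
by rewrite -[r]intz scaler_int !raddfMz /= -/(tens x m) fg.
Qed.

Definition balanced (V : zmodType) (h : X -> M -> V) : Prop :=
  [/\ forall x x' m, h (x + x') m = h x m + h x' m,
      forall x m m', h x (m + m') = h x m + h x m' &
      forall x (r : R) m, h ((r : R^c) *: x) m = h x (r *: m)].

Section TensorLift.
Variables (V : zmodType) (h : X -> M -> V) (hbal : balanced h).

Let hF : {linear free int (X * M)%type -> zmodule V} :=
  free_lift (fun p : (X * M)%type => h p.1 p.2 : zmodule V).

Lemma tensor_span_lift (z : free int (X * M)%type) : tensor_span z -> hF z = 0.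
Proof.
case: hbal => hDl hDr hM.
elim=> [_ [x x' m|x m m'|x r m]||y w _ y0 _ w0].
- by rewrite !raddfB /= !free_lift_basis /= hDl addrAC addrK subrr.
- by rewrite !raddfB /= !free_lift_basis /= hDr addrAC addrK subrr.
- by rewrite !raddfB /= !free_lift_basis /= hM subrr.
- exact: raddf0.
- by rewrite raddfB /= y0 w0 subrr.
Qed.

Definition tensor_lift_fun (_ : balanced h) (z : tensor) : V :=
  hF (repr (z : Quotient.quot tensor_null)).

Lemma tensor_lift_proj a : tensor_lift_fun hbal (tensor_proj a) = hF a.
Proof.
apply/eqP; rewrite -subr_eq0 -raddfB; apply/eqP/tensor_span_lift.
by apply/tensor_proj_eq; rewrite /tensor_proj reprK.
Qed.

Fact tensor_lift_is_zmod_morphism : zmod_morphism (tensor_lift_fun hbal).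
Proof.
move=> y z.
have [a ->] := tensor_proj_surj y; have [b ->] := tensor_proj_surj z.
by rewrite -raddfB !tensor_lift_proj raddfB.
Qed.
HB.instance Definition _ := GRing.isZmodMorphism.Build
  tensor V (tensor_lift_fun hbal) tensor_lift_is_zmod_morphism.
Definition tensor_lift : {additive tensor -> V} := tensor_lift_fun hbal.

Lemma tensor_lift_tens x m : tensor_lift (tens x m) = h x m.
Proof. by rewrite /= tensor_lift_proj /hF /= free_lift_basis. Qed.
End TensorLift.
End Tensor.

Section Lhom.
Variables (R : pzRingType) (M N : lmodType R).

Definition Lhom : Type := {linear M -> N}.

Lemma LhomP (f g : Lhom) : f =1 g -> f = g.
Proof.
case: f g => [f [[f0] [fZ]]] [g [[g0] [gZ]]] /= /funext fg.
case: _ / fg in g0 gZ *.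
by rewrite (Prop_irrelevance f0 g0) (Prop_irrelevance fZ gZ).
Qed.

HB.instance Definition _ := gen_eqMixin Lhom.
HB.instance Definition _ := gen_choiceMixin Lhom.

Definition Lhom0 : Lhom := \0.
Definition Lhom_opp (f : Lhom) : Lhom := \- f.
Definition Lhom_add (f g : Lhom) : Lhom := f \+ g.

Fact Lhom_addA : associative Lhom_add.
Proof. by move=> f g h; apply: LhomP => x /=; rewrite addrA. Qed.
Fact Lhom_addC : commutative Lhom_add.
Proof. by move=> f g; apply: LhomP => x /=; rewrite addrC. Qed.
Fact Lhom_add0 : left_id Lhom0 Lhom_add.
Proof. by move=> f; apply: LhomP => x /=; rewrite add0r. Qed.
Fact Lhom_addN : left_inverse Lhom0 Lhom_opp Lhom_add.
Proof. by move=> f; apply: LhomP => x /=; rewrite addNr. Qed.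
HB.instance Definition _ :=
  GRing.isZmodule.Build Lhom Lhom_addA Lhom_addC Lhom_add0 Lhom_addN.
End Lhom.

Section Precomposition.
Variables (R : pzRingType) (L M N : lmodType R) (d : {linear L -> M}).

Definition precomp_fun (f : Lhom M N) : Lhom L N := f \o d.

Fact precomp_is_zmod_morphism : zmod_morphism precomp_fun.
Proof. by move=> f g; apply: LhomP. Qed.
HB.instance Definition _ := GRing.isZmodMorphism.Build
  (Lhom M N) (Lhom L N) precomp_fun precomp_is_zmod_morphism.
Definition precomp : {additive Lhom M N -> Lhom L N} := precomp_fun.
End Precomposition.

Section TensorMap.
Variables (R : pzRingType) (X Y : lmodType R^c) (M : lmodType R).
Variable d : {linear X -> Y}.

Fact tensor_map_balanced : balanced (fun x (m : M) => tens (d x) m).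
Proof.
split=> [x x' m|x m m'|x r m]; first by rewrite raddfD tensDl.
  exact: tensDr.
by rewrite linearZ tensM.
Qed.
Definition tensor_mapl : {additive tensor X M -> tensor Y M} :=
  tensor_lift tensor_map_balanced.
End TensorMap.

Definition projective (R : pzRingType) (P : lmodType R) : Prop :=
  forall (M N : lmodType R) (g : {linear M -> N}) (f : {linear P -> N}),
    (forall y : N, exists x : M, g x = y) ->
    exists h : {linear P -> M}, forall p, g (h p) = f p.

Lemma free_projective (R : pzRingType) (X : choiceType) : projective (free R X).
Proof.
move=> M N g f g_surj; have [s sP] := choice g_surj.
exists (free_lift (fun x => s (f (basis R x)))) => p.
apply: (@free_additive_ext _ _ _ (g \o free_lift _) f) => r x.
by rewrite /= !linearZ -/(free_lift _) free_lift_basis sP.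
Qed.

(* The standard free resolution of M: the n-th term is the free module on the
   underlying set of the n-th syzygy, starting from the zeroth syzygy M. *)

Section StandardResolution.
Variables (R : pzRingType) (M : lmodType R).

Definition free_eval (N : lmodType R) : {linear free R N -> N} :=
  free_lift (fun x : N => x).

Fixpoint syzygy (n : nat) : lmodType R :=
  if n is n'.+1 then kernel (free_eval (syzygy n')) else M.

Definition res (n : nat) : lmodType R := free R (syzygy n).

Definition res_diff (n : nat) : {linear res n.+1 -> res n} :=
  (val : kernel (free_eval (syzygy n)) -> res n) \o free_eval (syzygy n.+1).

Lemma free_eval_surj (N : lmodType R) (x : N) : exists a, free_eval N a = x.
Proof. by exists (basis R x); rewrite free_lift_basis. Qed.

Lemma res_exact0 : exact_at (res_diff 0) (free_eval M).
Proof.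
move=> y; split=> [/eqP y0|[x <-]]; last exact/eqP/kernel_valP.
have [a aP] := free_eval_surj (Kernel y0 : syzygy 1).
by exists a; rewrite /res_diff /= [X in val X]aP.
Qed.

Lemma res_exact n : exact_at (res_diff n.+1) (res_diff n).
Proof.
move=> y; split=> [y0|[x <-]]; last first.
  pose k : kernel (free_eval (syzygy n.+1)) := free_eval (syzygy n.+2) x.
  have k0 : free_eval (syzygy n.+1) (kernel_val k) = 0 := eqP (kernel_valP k).
  by rewrite /res_diff /= [X in val X]k0.
have /eqP y0' : free_eval (syzygy n.+1) y = 0 by apply: val_inj.
have [a aP] := free_eval_surj (Kernel y0' : syzygy n.+2).
by exists a; rewrite /res_diff /= [X in val X]aP.
Qed.
End StandardResolution.

Definition Ext (R : pzRingType) (i : nat) (M N : lmodType R) : zmodType :=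
  if i is j.+1
  then homology (precomp N (res_diff M j)) (precomp N (res_diff M j.+1))
  else kernel (precomp N (res_diff M 0)).

Definition Tor (R : pzRingType) (i : nat) (X : lmodType R^c) (M : lmodType R) :
    zmodType :=
  if i is j.+1
  then homology (tensor_mapl M (res_diff X j.+1)) (tensor_mapl M (res_diff X j))
  else homology (tensor_mapl M (res_diff X 0))
         (\0 : {additive tensor (res X 0) M -> tensor (res X 0) M}).

HB.mixin Record isBimodule (S R : pzRingType) C of GRing.Lmodule S C := {
  rmul : C -> R -> C;
  rmulA : forall c r r', rmul (rmul c r) r' = rmul c (r * r');
  rmul1 : forall c, rmul c 1 = c;
  rmulDl : forall c c' r, rmul (c + c') r = rmul c r + rmul c' r;
  rmulDr : forall c r r', rmul c (r + r') = rmul c r + rmul c r';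
  scale_rmul : forall s c r, s *: rmul c r = rmul (s *: c) r
}.

#[short(type="bimodType")]
HB.structure Definition Bimodule (S R : pzRingType) :=
  {C of GRing.Lmodule S C & isBimodule S R C}.

Section BimoduleTheory.
Variables (S R : pzRingType) (C : bimodType S R).

(* C as a right R-module. *)
Definition rmod : Type := C.
HB.instance Definition _ := GRing.Zmodule.on rmod.

Definition rmod_scale (r : R^c) (c : rmod) : rmod := rmul (c : C) (r : R).

Fact rmod_scaleA (r r' : R^c) c :
  rmod_scale r (rmod_scale r' c) = rmod_scale (r * r') c.
Proof. exact: rmulA. Qed.
Fact rmod_scale1 : left_id 1 rmod_scale.
Proof. exact: rmul1. Qed.
Fact rmod_scaleDr : right_distributive rmod_scale +%R.
Proof. by move=> r c c'; exact: rmulDl. Qed.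
Fact rmod_scaleDl c : {morph rmod_scale^~ c : r r' / r + r'}.
Proof. by move=> r r'; exact: rmulDr. Qed.
HB.instance Definition _ := GRing.Zmodule_isLmodule.Build R^c rmod
  rmod_scaleA rmod_scale1 rmod_scaleDr rmod_scaleDl.
End BimoduleTheory.

(* For an (S, R)-bimodule C: the left S-module C (x)_R M, with
   s (c (x) m) = (s c) (x) m. *)

Section BimoduleTensor.
Variables (S R : pzRingType) (C : bimodType S R) (M : lmodType R).

Fact btensor_scale_balanced (s : S) :
  balanced (fun (c : rmod C) (m : M) => tens (s *: (c : C) : rmod C) m).
Proof.
split=> [c c' m|c m m'|c r m]; last 1 first.
- by rewrite -tensM; congr tens; exact: scale_rmul.
- by rewrite -tensDl; congr tens; exact: (scalerDr s (c : C) c').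
- exact: tensDr.
Qed.

Definition btensor : Type := tensor (rmod C) M.
HB.instance Definition _ := GRing.Zmodule.on btensor.

Definition btens (c : C) (m : M) : btensor := tens (c : rmod C) m.

Definition btensor_scale (s : S) : {additive btensor -> btensor} :=
  tensor_lift (btensor_scale_balanced s).

Lemma btensor_scaleE s c m : btensor_scale s (btens c m) = btens (s *: c) m.
Proof. exact: tensor_lift_tens. Qed.

Fact btensor_scaleA s t z :
  btensor_scale s (btensor_scale t z) = btensor_scale (s * t) z.
Proof.
move: z; apply: (@tensor_ext _ _ _ _ (btensor_scale s \o btensor_scale t)).
by move=> c m; rewrite /= !btensor_scaleE scalerA.
Qed.
Fact btensor_scale1 : left_id 1 (fun s => btensor_scale s).
Proof.
apply: (@tensor_ext _ _ _ _ (btensor_scale 1) idfun) => c m.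
by rewrite /= btensor_scaleE scale1r.
Qed.
Fact btensor_scaleDr : right_distributive (fun s => btensor_scale s) +%R.
Proof. by move=> s; exact: raddfD. Qed.
Fact btensor_scaleDl z : {morph (fun s => btensor_scale s z) : s t / s + t}.
Proof.
move=> s t; move: z.
apply: (@tensor_ext _ _ _ _ (btensor_scale (s + t))
          (btensor_scale s \+ btensor_scale t)) => c m.
by rewrite /= !btensor_scaleE scalerDl [LHS]tensDl.
Qed.
HB.instance Definition _ := GRing.Zmodule_isLmodule.Build S btensor
  btensor_scaleA btensor_scale1 btensor_scaleDr btensor_scaleDl.
End BimoduleTensor.

(* The left R-module Hom_S(C, N), with (r f)(c) = f(c r). *)

Section BimoduleHom.
Variables (S R : pzRingType) (C : bimodType S R) (N : lmodType S).

Definition bhom : Type := Lhom C N.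
HB.instance Definition _ := GRing.Zmodule.on bhom.

Definition rmulr (r : R) (c : C) : C := rmul c r.
Fact rmulr_is_linear r : linear (rmulr r).
Proof. by move=> s c c'; rewrite /rmulr rmulDl scale_rmul. Qed.
HB.instance Definition _ r :=
  GRing.isLinear.Build S C C *:%R (rmulr r) (rmulr_is_linear r).

Definition bhom_scale (r : R) (f : bhom) : bhom :=
  (f : {linear C -> N}) \o rmulr r.

Fact bhom_scaleA r t f : bhom_scale r (bhom_scale t f) = bhom_scale (r * t) f.
Proof. by apply: LhomP => c /=; rewrite /rmulr rmulA. Qed.
Fact bhom_scale1 : left_id 1 bhom_scale.
Proof. by move=> f; apply: LhomP => c /=; rewrite /rmulr rmul1. Qed.
Fact bhom_scaleDr : right_distributive bhom_scale +%R.
Proof. by move=> r f g; apply: LhomP. Qed.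
Fact bhom_scaleDl f : {morph bhom_scale^~ f : r t / r + t}.
Proof.
by move=> r t; apply: LhomP => c /=; rewrite /rmulr rmulDr -[RHS]raddfD.
Qed.
HB.instance Definition _ := GRing.Zmodule_isLmodule.Build R bhom
  bhom_scaleA bhom_scale1 bhom_scaleDr bhom_scaleDl.
End BimoduleHom.

Section NaturalMaps.
Variables (S R : pzRingType) (C : bimodType S R).

Fact homothetyl_is_linear (s : S) :
  linear (fun c : rmod C => s *: (c : C) : rmod C).
Proof.
move=> r c c'; rewrite -[RHS]/(rmul (s *: (c : C)) r + s *: (c' : C)).
by rewrite -scale_rmul; exact: (scalerDr s (rmul (c : C) r) c').
Qed.
(* S -> Hom_{R^op}(C, C), s |-> (c |-> s c) *)
Definition homothetyl (s : S) : Lhom (rmod C) (rmod C) :=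
  HB.pack (fun c : rmod C => s *: (c : C) : rmod C)
    (GRing.isLinear.Build _ _ _ _ _ (homothetyl_is_linear s)).
(* R -> Hom_S(C, C), r |-> (c |-> c r) *)
Definition homothetyr (r : R) : Lhom C C := rmulr r.

Section Mu.
Variable M : lmodType R.

Fact mu_fun_is_linear (m : M) : linear (fun c : C => btens c m).
Proof.
move=> s c c'; rewrite [LHS]tensDl; congr (_ + _).
by rewrite -[LHS]btensor_scaleE.
Qed.
Definition mu_fun (m : M) : bhom C (btensor C M) :=
  HB.pack (fun c : C => btens c m)
    (GRing.isLinear.Build _ _ _ _ _ (mu_fun_is_linear m)).

Fact mu_is_linear : linear mu_fun.
Proof.
move=> r m m'; apply: LhomP => c /=.
by rewrite [LHS]tensDr -tensM.
Qed.
HB.instance Definition _ :=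
  GRing.isLinear.Build R M (bhom C (btensor C M)) *:%R mu_fun mu_is_linear.
Definition mu : {linear M -> bhom C (btensor C M)} := mu_fun.
End Mu.

Section Nu.
Variable N : lmodType S.

Fact nu_balanced :
  balanced (fun (c : rmod C) (f : bhom C N) => (f : {linear C -> N}) (c : C)).
Proof. by split=> // c c' f; rewrite [LHS]raddfD. Qed.
Definition nu_fun (z : btensor C (bhom C N)) : N := tensor_lift nu_balanced z.

Fact nu_is_linear : linear nu_fun.
Proof.
move=> s y z; rewrite /nu_fun [LHS]raddfD; congr (_ + _); move: y.
pose T := tensor_lift nu_balanced.
have sT : zmod_morphism (fun y => s *: T y).
  by move=> y y'; rewrite raddfB scalerBr.
pose sT' : {additive _ -> _} :=
  HB.pack (fun y => s *: T y) (GRing.isZmodMorphism.Build _ _ _ sT).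
apply: (@tensor_ext _ _ _ _ (T \o btensor_scale C (bhom C N) s) sT') => c f.
by rewrite /= btensor_scaleE /T !tensor_lift_tens linearZ.
Qed.
HB.instance Definition _ :=
  GRing.isLinear.Build S (btensor C (bhom C N)) N *:%R nu_fun nu_is_linear.
Definition nu : {linear btensor C (bhom C N) -> N} := nu_fun.

Lemma nuE c (f : bhom C N) : nu (btens c f) = (f : {linear C -> N}) c.
Proof. exact: tensor_lift_tens. Qed.
End Nu.
End NaturalMaps.

Definition finitely_generated (R : pzRingType) (M : lmodType R) : Prop :=
  exists (n : nat) (e : 'I_n -> M),
    forall x : M, exists a : 'I_n -> R, x = \sum_i a i *: e i.

Definition degreewise_finite_projective_resolution
    (R : pzRingType) (M : lmodType R) : Prop :=
  exists (P : nat -> lmodType R) (d : forall n, {linear P n.+1 -> P n})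
         (e : {linear P 0 -> M}),
  [/\ forall n, projective (P n) /\ finitely_generated (P n),
      forall x : M, exists p, e p = x,
      exact_at (d 0) e &
      forall n, exact_at (d n.+1) (d n)].

Section FoxbyClasses.
Variables (S R : pzRingType) (C : bimodType S R).

Record semidualizing : Prop := Semidualizing {
  sd_a1 : degreewise_finite_projective_resolution (C : lmodType S);
  sd_a2 : degreewise_finite_projective_resolution (rmod C : lmodType R^c);
  sd_b1 : bijective (@homothetyl S R C);
  sd_b2 : bijective (@homothetyr S R C);
  sd_c1 : forall i, (1 <= i)%N -> trivial_module (Ext i C C);
  sd_c2 : forall i, (1 <= i)%N -> trivial_module (Ext i (rmod C) (rmod C))
}.

Definition faithfully_semidualizing : Prop :=
  [/\ semidualizing,
      forall N : lmodType S, trivial_module (Lhom C N) -> trivial_module N &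
      forall M : lmodType R^c,
        trivial_module (Lhom (rmod C) M) -> trivial_module M].

Definition Auslander (M : lmodType R) : Prop :=
  [/\ forall i, (1 <= i)%N -> trivial_module (Tor i (rmod C) M),
      forall i, (1 <= i)%N -> trivial_module (Ext i C (btensor C M)) &
      bijective (mu C M)].

Definition Bass (N : lmodType S) : Prop :=
  [/\ forall i, (1 <= i)%N -> trivial_module (Ext i C N),
      forall i, (1 <= i)%N -> trivial_module (Tor i (rmod C) (bhom C N)) &
      bijective (nu C N)].
End FoxbyClasses.

Definition two_of_three (R : pzRingType) (P : lmodType R -> Prop) : Prop :=
  forall (M' M M'' : lmodType R) (f : {linear M' -> M}) (g : {linear M -> M''}),
    short_exact f g ->
    [/\ P M' -> P M -> P M'', P M' -> P M'' -> P M & P M -> P M'' -> P M'].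

(* Main.v *)
Require Import Defs.
From HB Require Import structures.
From mathcomp Require Import all_boot all_order all_algebra.
From mathcomp Require Import finmap all_classical.

(** Everything reduces to long exact sequences, the five lemma and
    faithfulness.  For B_C, let 0 -> N' -> N -> N'' -> 0 be exact.  If N' is in
    B_C, then Hom(C, -) keeps the sequence exact, and one compares
    C (x) Hom(C, -) with the identity through nu.  If N and N'' are in B_C, then
    C (x) Hom(C, N) -> C (x) Hom(C, N'') is the surjection N -> N'', so C (x) K = 0
    for K the cokernel of Hom(C, N) -> Hom(C, N''); by adjunction
    Hom(C, Hom_Z(K, K)) = Hom_Z(C (x) K, K) = 0, so Hom_Z(K, K) = 0 and K = 0.
    Dually, if M' and M are in A_C, then K = ker(C (x) M' -> C (x) M) satisfies
    Hom(C, K) = ker(M' -> M) = 0, so K = 0 and Tor_1(C, M'') = 0. *)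

Set Implicit Arguments.
Unset Strict Implicit.
Unset Printing Implicit Defensive.

(* [Defs] again, because MathComp's [vector.free] shadows [Defs.free]. *)
Import Defs GRing.Theory.
Local Open Scope ring_scope.

(** * Diagram chases *)

(** Only the inclusion of the kernel in the image: [homology] divides the cycles by those boundaries
    that are cycles, and makes sense without [g \o f = 0]. *)
Definition acyclic_at (U V W : zmodType) (f : U -> V) (g : V -> W) : Prop :=
  forall y, g y = 0 -> exists x, f x = y.

Lemma homology_trivialP (U V W : zmodType)
    (f : {additive U -> V}) (g : {additive V -> W}) :
  trivial_module (homology f g) <-> acyclic_at f g.
Proof.
split=> [H0 y /eqP y0|fg0 z]; last first.
  rewrite -[z]reprK; apply/eqP.
  rewrite -[X in _ == X](raddf0 (\pi_(homology f g))%qT) -Quotient.idealrBE subr0.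
  by apply/asboolP/fg0/eqP/kernel_valP.
have := H0 (\pi_(homology f g) (Kernel y0))%qT.
rewrite -[X in _ = X -> _](raddf0 (\pi_(homology f g))%qT) => /eqP.
by rewrite -Quotient.idealrBE subr0 => /asboolP.
Qed.

(** * Ladders of three complexes: pieces of the long exact homology sequence *)

Section Ladder.
Variables (A3 A2 A1 A0 B3 B2 B1 B0 D3 D2 D1 D0 : zmodType).
Variables (a3 : {additive A3 -> A2}) (a2 : {additive A2 -> A1}) (a1 : {additive A1 -> A0}).
Variables (b3 : {additive B3 -> B2}) (b2 : {additive B2 -> B1}) (b1 : {additive B1 -> B0}).
Variables (c3 : {additive D3 -> D2}) (c2 : {additive D2 -> D1}) (c1 : {additive D1 -> D0}).
Variables (f3 : {additive A3 -> B3}) (f2 : {additive A2 -> B2}).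
Variables (f1 : {additive A1 -> B1}) (f0 : {additive A0 -> B0}).
Variables (g3 : {additive B3 -> D3}) (g2 : {additive B2 -> D2}).
Variables (g1 : {additive B1 -> D1}).
Hypotheses (fd3 : forall x, f2 (a3 x) = b3 (f3 x)) (fd2 : forall x, f1 (a2 x) = b2 (f2 x)).
Hypotheses (fd1 : forall x, f0 (a1 x) = b1 (f1 x)).
Hypotheses (gd3 : forall x, g2 (b3 x) = c3 (g3 x)) (gd2 : forall x, g1 (b2 x) = c2 (g2 x)).
Hypotheses (dd2 : forall x, b2 (b3 x) = 0) (dd1 : forall x, b1 (b2 x) = 0).
Hypotheses (fg2 : exact_at f2 g2) (fg1 : exact_at f1 g1).

(** A bounding element for [g2 y] in [D] is lifted to [B] and corrects [y] by a boundary into [A],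
    where it bounds. Each ladder lemma asks for injectivity and surjectivity in one degree only,
    since at the end of an augmented resolution one of them may fail. *)
Lemma ladder_mid : injective f1 -> (forall z, exists y, g3 y = z) ->
  acyclic_at a3 a2 -> acyclic_at c3 c2 -> acyclic_at b3 b2.
Proof.
move=> f1I g3S exA exD y y0.
have [|z zP] := exD (g2 y); first by rewrite -gd2 y0 raddf0.
have [w wP] := g3S z.
have [|x xP] := (fg2 (y - b3 w)).1; first by rewrite raddfB gd3 wP zP subrr.
have [|x' x'P] := exA x.
  by apply: f1I; rewrite fd2 xP raddfB y0 dd2 subr0 raddf0.
by exists (w + f3 x'); rewrite raddfD -fd3 x'P xP addrC subrK.
Qed.

(** The bounding element is found in the image of [g3], which says more than exactness of [D] as
    long as [g3] is not known to be onto. The surjectivity of [Hom(P, M) -> Hom(P, M'')] is deduced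
    from this. *)
Lemma ladder_lift : injective f0 -> (forall z, exists y, g2 y = z) ->
  acyclic_at b3 b2 -> acyclic_at a2 a1 ->
  forall z, c2 z = 0 -> exists w, c3 (g3 w) = z.
Proof.
move=> f0I g2S exB exA z z0; have [y yP] := g2S z.
(* Here [x] represents the connecting homomorphism at [z]; it bounds, so [y] can be corrected to a
   cycle. *)
have [|x xP] := (fg1 (b2 y)).1; first by rewrite gd2 yP.
have [|x' x'P] := exA x; first by apply: f0I; rewrite fd1 xP dd1 raddf0.
have [|w wP] := exB (y - f2 x'); first by rewrite raddfB -fd2 x'P xP subrr.
exists w; rewrite -gd3 wP raddfB yP.
by rewrite (fg2 (f2 x')).2 ?subr0 //; exists x'.
Qed.

Lemma ladder_right : injective f0 -> (forall z, exists y, g2 y = z) ->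
  acyclic_at b3 b2 -> acyclic_at a2 a1 -> acyclic_at c3 c2.
Proof.
by move=> f0I g2S exB exA z /(ladder_lift f0I g2S exB exA)[w]; exists (g3 w).
Qed.

Lemma ladder_connect : injective f1 -> (forall z, exists y, g3 y = z) ->
  acyclic_at c3 c2 ->
  forall x y, f1 x = b2 y -> exists x', a2 x' = x.
Proof.
move=> f1I g3S exD x y xy.
have [|z zP] := exD (g2 y).
  by rewrite -gd2 -xy (fg1 _).2 //; exists x.
have [w wP] := g3S z.
have [|x' x'P] := (fg2 (y - b3 w)).1; first by rewrite raddfB gd3 wP zP subrr.
by exists x'; apply: f1I; rewrite fd2 x'P raddfB dd2 subr0.
Qed.

Lemma ladder_left : injective f1 -> (forall z, exists y, g3 y = z) ->
  acyclic_at c3 c2 -> acyclic_at b2 b1 -> acyclic_at a2 a1.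
Proof.
move=> f1I g3S exD exB x x0.
have [|y yP] := exB (f1 x); first by rewrite -fd1 x0 raddf0.
exact: (ladder_connect f1I g3S exD (esym yP)).
Qed.
End Ladder.

Lemma additive_inj (U V : zmodType) (h : {additive U -> V}) :
  (forall x, h x = 0 -> x = 0) -> injective h.
Proof.
move=> h0 x y xy; apply/eqP; rewrite -subr_eq0; apply/eqP/h0.
by rewrite raddfB /= xy subrr.
Qed.

Lemma inj_surj_bijective (T : choiceType) (U : Type) (h : T -> U) :
  injective h -> (forall z, exists y, h y = z) -> bijective h.
Proof.
move=> hI hS; have [k kK] := choice hS; exists k => // x.
by apply: hI; rewrite kK.
Qed.

Lemma bijective_surj (T U : Type) (h : T -> U) :
  bijective h -> forall z, exists y, h y = z.
Proof. by case=> k _ kK z; exists (k z). Qed.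

(** * The short five lemma *)

Section FiveLemma.
Variables (A B D A' B' D' : zmodType).
Variables (f : {additive A -> B}) (g : {additive B -> D}).
Variables (f' : {additive A' -> B'}) (g' : {additive B' -> D'}).
Variables (a : {additive A -> A'}) (b : {additive B -> B'}) (c : {additive D -> D'}).
Hypotheses (fI : injective f) (fg : exact_at f g) (gS : forall z, exists y, g y = z).
Hypotheses (fI' : injective f') (fg' : exact_at f' g').
Hypotheses (gS' : forall z, exists y, g' y = z).
Hypotheses (fab : forall x, f' (a x) = b (f x)) (gbc : forall y, g' (b y) = c (g y)).

Lemma five_mid : bijective a -> bijective c -> bijective b.
Proof.
move=> aB cB; apply: inj_surj_bijective => [|y'].
  apply: additive_inj => y y0.
  have gy0 : g y = 0 by apply: (bij_inj cB); rewrite -gbc y0 !raddf0.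
  have [x xP] := (fg y).1 gy0.
  have x0 : x = 0 by apply: (bij_inj aB); apply: fI'; rewrite fab xP y0 !raddf0.
  by rewrite -xP x0 raddf0.
have [z zP] := bijective_surj cB (g' y'); have [y yP] := gS z.
have [|x' x'P] := (fg' (y' - b y)).1; first by rewrite raddfB gbc yP zP subrr.
have [x xP] := bijective_surj aB x'.
by exists (f x + y); rewrite raddfD -fab xP x'P subrK.
Qed.

(** Both rows enter through left exactness, which [Hom] always preserves. *)
Lemma five_left : bijective b -> bijective c -> bijective a.
Proof.
move=> bB cB; apply: inj_surj_bijective => [|x'].
  apply: additive_inj => x x0.
  by apply: fI; apply: (bij_inj bB); rewrite -fab x0 !raddf0.
have [y yP] := bijective_surj bB (f' x').
have gy0 : g y = 0.
  by apply: (bij_inj cB); rewrite -gbc yP raddf0; apply/fg'; exists x'.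
have [x xP] := (fg y).1 gy0.
by exists x; apply: fI'; rewrite fab xP.
Qed.

(** The dual chase, through right exactness of both rows, which tensoring always preserves. *)
Lemma five_right : bijective a -> bijective b -> bijective c.
Proof.
move=> aB bB; apply: inj_surj_bijective => [|z'].
  apply: additive_inj => z; have [y <-] := gS z; rewrite -gbc => /fg'[x' x'P].
  have [x xP] := bijective_surj aB x'; apply/fg; exists x.
  by apply: (bij_inj bB); rewrite -fab xP.
have [y' <-] := gS' z'; have [y <-] := bijective_surj bB y'.
by exists (g y); rewrite -gbc.
Qed.
End FiveLemma.

(** * Tensor products *)

Section TensorFunctor.
Variable R : pzRingType.

(** Closure under differences also gives sums and opposites, hence all integer combinations of the
    [tens x m], and these exhaust the tensor product. *)
Lemma tensor_ind (X : lmodType R^c) (M : lmodType R) (P : tensor X M -> Prop) :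
  P 0 -> (forall y z, P y -> P z -> P (y - z)) -> (forall x m, P (tens x m)) ->
  forall z, P z.
Proof.
move=> P0 PB PT z.
have PD y w : P y -> P w -> P (y + w).
  by move=> Py Pw; rewrite -[w]opprK -[- w]sub0r; apply/PB/PB.
have [a ->] := tensor_proj_surj z; rewrite [a]free_basisE /= /free_lift_fun.
rewrite raddf_sum /=; elim/big_ind: _ => // -[x m] _.
rewrite -[X in X *: _]intz scaler_int raddfMz /= -/(tens x m).
have Pn n : P (tens x m *+ n) by elim: n => [|n IHn]; rewrite ?mulr0n // mulrS; apply: PD.
case: (free_val a (x, m) : int) => n; first exact: Pn.
by rewrite NegzE mulrNz -sub0r; apply: PB => //; exact: Pn.
Qed.

Section Right.
Variables (X : lmodType R^c) (M N : lmodType R) (g : {linear M -> N}).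

Fact tensor_mapr_balanced : balanced (fun (x : X) m => tens x (g m)).
Proof.
split=> [x x' m|x m m'|x r m]; first exact: tensDl.
  by rewrite raddfD tensDr.
by rewrite linearZ tensM.
Qed.
Definition tensor_mapr : {additive tensor X M -> tensor X N} :=
  tensor_lift tensor_mapr_balanced.

Lemma tensor_maprE x m : tensor_mapr (tens x m) = tens x (g m).
Proof. exact: tensor_lift_tens. Qed.
End Right.

Lemma tensor_maplE (X Y : lmodType R^c) (M : lmodType R) (d : {linear X -> Y}) x m :
  tensor_mapl M d (tens x m) = tens (d x) m.
Proof. exact: tensor_lift_tens. Qed.

Lemma tensor_mapC (X Y : lmodType R^c) (M N : lmodType R) (d : {linear X -> Y})
    (g : {linear M -> N}) z :
  tensor_mapr Y g (tensor_mapl M d z) = tensor_mapl N d (tensor_mapr X g z).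
Proof.
move: z; apply: (@tensor_ext _ _ _ _ (tensor_mapr Y g \o tensor_mapl M d)
  (tensor_mapl N d \o tensor_mapr X g)) => x m /=.
by rewrite tensor_maplE !tensor_maprE tensor_maplE.
Qed.

Lemma tens0r (X : lmodType R^c) (M : lmodType R) (x : X) : tens x (0 : M) = 0.
Proof. by apply: (addrI (tens x 0)); rewrite -tensDr !addr0. Qed.

Lemma tens0l (X : lmodType R^c) (M : lmodType R) (m : M) : tens (0 : X) m = 0.
Proof. by apply: (addrI (tens 0 m)); rewrite -tensDl !addr0. Qed.

Lemma tensBr (X : lmodType R^c) (M : lmodType R) (x : X) (m n : M) :
  tens x (m - n) = tens x m - tens x n.
Proof. by apply: (addIr (tens x n)); rewrite -tensDr !subrK. Qed.

Lemma tensBl (X : lmodType R^c) (M : lmodType R) (x y : X) (m : M) :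
  tens (x - y) m = tens x m - tens y m.
Proof. by apply: (addIr (tens y m)); rewrite -tensDl !subrK. Qed.

Lemma tensor_mapl0 (X Y Z : lmodType R^c) (M : lmodType R)
    (d : {linear X -> Y}) (e : {linear Y -> Z}) :
  (forall x, e (d x) = 0) -> forall z, tensor_mapl M e (tensor_mapl M d z) = 0.
Proof.
move=> ed0; apply: (@tensor_ext _ _ _ _ (tensor_mapl M e \o tensor_mapl M d) \0).
by move=> x m /=; rewrite !tensor_maplE ed0 tens0l.
Qed.
End TensorFunctor.

(** * Cokernels and right exactness of the tensor product *)

Section Image.
Variables (U V : zmodType) (f : {additive U -> V}).

Definition image_pred : {pred V} := fun y => `[< exists x, f x = y >].

Fact image_zmod_closed : zmod_closed image_pred.
Proof.
split=> [|y z /asboolP[a <-] /asboolP[b <-]]; apply/asboolP.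
  by exists 0; rewrite raddf0.
by exists (a - b); rewrite raddfB.
Qed.
HB.instance Definition _ := GRing.isZmodClosed.Build V image_pred image_zmod_closed.

Definition cokernel : zmodType := Quotient.quot image_pred.
Definition coker_proj (y : V) : cokernel := (\pi_cokernel y)%qT.

Fact coker_proj_is_zmod_morphism : zmod_morphism coker_proj.
Proof. by move=> y z; rewrite /coker_proj raddfB. Qed.
HB.instance Definition _ :=
  GRing.isZmodMorphism.Build V cokernel coker_proj coker_proj_is_zmod_morphism.

Lemma coker_proj_eq0 (y : V) : coker_proj y = 0 <-> exists x, f x = y.
Proof.
rewrite -(raddf0 coker_proj); split=> [/eqP|yP].
  by rewrite -Quotient.idealrBE subr0 => /asboolP.
by apply/eqP; rewrite -Quotient.idealrBE subr0; apply/asboolP.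
Qed.

Lemma coker_proj_surj (z : cokernel) : exists y, coker_proj y = z.
Proof. by exists (repr z); rewrite /coker_proj reprK. Qed.
End Image.

(* The inverse of the map induced on the cokernel of [k] by [p (x) q] sends
   [x (x) m] to the class of [s x (x) t m], for arbitrary sections [s] and [t]. *)
Lemma tensor_right_exact (R : pzRingType) (U : zmodType)
    (X Y : lmodType R^c) (M N : lmodType R)
    (k : {additive U -> tensor X M}) (p : {linear X -> Y}) (q : {linear M -> N}) :
  (forall y, exists x, p x = y) -> (forall n, exists m, q m = n) ->
  (forall x m, p x = 0 \/ q m = 0 -> exists u, k u = tens x m) ->
  forall z, tensor_mapl N p (tensor_mapr X q z) = 0 -> exists u, k u = z.
Proof.
move=> pS qS kE; have [s sP] := choice pS; have [t tP] := choice qS.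
pose h (y : Y) (n : N) : cokernel k := coker_proj k (tens (s y) (t n)).
have hE x m : h (p x) (q m) = coker_proj k (tens x m).
  apply/eqP; rewrite -subr_eq0 -raddfB; apply/eqP/coker_proj_eq0.
  (* One summand has its left factor in the kernel of [p], the other its right factor in the kernel
     of [q]; both lie in the image of [k], so the class is independent of the sections. *)
  have -> : tens (s (p x)) (t (q m)) - tens x m =
     tens (s (p x) - x) (t (q m)) + tens x (t (q m) - m).
    by rewrite tensBl tensBr addrA subrK.
  have [|u <-] := kE (s (p x) - x) (t (q m)); first by left; rewrite raddfB /= sP subrr.
  have [|v <-] := kE x (t (q m) - m); first by right; rewrite raddfB /= tP subrr.
  by exists (u + v); rewrite raddfD.
have hbal : balanced h.
  split=> [y y' n|y n n'|y r n]; move: (pS y) (qS n) => [x <-] [m <-].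
  - by have [x' <-] := pS y'; rewrite -raddfD !hE tensDl raddfD.
  - by have [m' <-] := qS n'; rewrite -raddfD !hE tensDr raddfD.
  - by rewrite -!linearZ !hE tensM.
have hK z : tensor_lift hbal (tensor_mapl N p (tensor_mapr X q z)) = coker_proj k z.
  move: z; apply: (@tensor_ext _ _ _ _
    (tensor_lift hbal \o (tensor_mapl N p \o tensor_mapr X q)) (coker_proj k)) => x m /=.
  by rewrite tensor_maprE tensor_maplE tensor_lift_tens hE.
by move=> z z0; apply/coker_proj_eq0; rewrite -hK z0 raddf0.
Qed.

Section TensorExact.
Variable R : pzRingType.

Lemma tensor_mapr_exact (X : lmodType R^c) (M' M M'' : lmodType R)
    (f : {linear M' -> M}) (g : {linear M -> M''}) :
  exact_at f g -> (forall z, exists y, g y = z) ->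
  exact_at (tensor_mapr X f) (tensor_mapr X g).
Proof.
move=> fg gS y; split=> [y0|[x <-]].
  apply: (@tensor_right_exact _ _ _ _ _ _ (tensor_mapr X f) (idfun : {linear X -> X}) g) => //.
  - by move=> x; exists x.
  - move=> x m [/= ->|/fg[m' <-]]; last by exists (tens x m'); rewrite tensor_maprE.
    by exists 0; rewrite raddf0 tens0l.
  - by rewrite y0 raddf0.
move: x; apply: (@tensor_ext _ _ _ _ (tensor_mapr X g \o tensor_mapr X f) \0) => x m /=.
by rewrite !tensor_maprE (fg (f m)).2 ?tens0r //; exists m.
Qed.

Lemma tensor_mapr_surj (X : lmodType R^c) (M N : lmodType R) (g : {linear M -> N}) :
  (forall z, exists y, g y = z) -> forall z, exists y, tensor_mapr X g y = z.
Proof.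
move=> gS; apply: tensor_ind => [|_ _ [y <-] [z <-]|x n].
- by exists 0; rewrite raddf0.
- by exists (y - z); rewrite raddfB.
- by have [m <-] := gS n; exists (tens x m); rewrite tensor_maprE.
Qed.

Lemma tensor_mapl_exact (X' X X'' : lmodType R^c) (M : lmodType R)
    (f : {linear X' -> X}) (g : {linear X -> X''}) :
  exact_at f g -> (forall z, exists y, g y = z) ->
  exact_at (tensor_mapl M f) (tensor_mapl M g).
Proof.
move=> fg gS y; split=> [y0|[x <-]]; last first.
  by apply: tensor_mapl0 => x'; apply/fg; exists x'.
apply: (@tensor_right_exact _ _ _ _ _ _ (tensor_mapl M f) g (idfun : {linear M -> M})) => //.
- by move=> m; exists m.
- move=> x m [/fg[x' <-]|/= ->]; first by exists (tens x' m); rewrite tensor_maplE.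
  by exists 0; rewrite raddf0 tens0r.
- by rewrite -tensor_mapC y0 raddf0.
Qed.

Lemma tensor_mapl_surj (X Y : lmodType R^c) (M : lmodType R) (g : {linear X -> Y}) :
  (forall z, exists y, g y = z) -> forall z, exists y, tensor_mapl M g y = z.
Proof.
move=> gS; apply: tensor_ind => [|_ _ [y <-] [z <-]|x n].
- by exists 0; rewrite raddf0.
- by exists (y - z); rewrite raddfB.
- by have [m <-] := gS x; exists (tens m n); rewrite tensor_maplE.
Qed.

(** * Flatness of free modules *)

Section FreeFlat.
Variable X : choiceType.

Section Coordinates.
Variable M : lmodType R.

Fact coord_balanced (x : X) :
  balanced (fun (a : free R^c X) (m : M) => (free_val a x : R) *: m).
Proof.
split=> [a b m|a m n|a r m]; first exact: scalerDl.
  exact: scalerDr.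
by rewrite scalerA.
Qed.
(** The component at [x] of the isomorphism of [F (x) M], with [F] free on [X], with a direct sum of
    copies of [M]. *)
Definition free_coord x : {additive tensor (free R^c X) M -> M} :=
  tensor_lift (coord_balanced x).

(** The expansion is asserted over every larger [B], so that two tensors with different supports can
    be expanded over a common index set. *)
Lemma free_coord_sum (z : tensor (free R^c X) M) : exists A : {fset X},
  forall B : {fset X}, (A `<=` B)%fset ->
    z = \sum_(x <- B) tens (basis R^c x) (free_coord x z).
Proof.
move: z; apply: tensor_ind => [|y z [A AP] [B BP]|a m].
- by exists fset0 => B _; rewrite big1 // => x _; rewrite raddf0 tens0r.
- exists (A `|` B)%fset => E /fsubUsetP[AE BE].
  rewrite {1}[y](AP E) // {1}[z](BP E) // -sumrB; apply: eq_bigr => x _.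
  by rewrite raddfB tensBr.
- have [A AP] := free_supp a; exists A => B /fsubsetP AB.
  have aB x : x \notin B -> free_val a x = 0.
    by move=> xB; apply: AP; apply: contra xB; apply: AB.
  rewrite {1}[a]free_basisE [free_lift _ _](@free_lift_funE _ _ _ _ _ B) //.
  rewrite (big_morph (fun b => tens b m) (fun b c => tensDl b c m) (tens0l _ m)).
  by apply: eq_bigr => x _; rewrite tensM tensor_lift_tens.
Qed.
End Coordinates.

(** Coordinates commute with the induced map, so a tensor killed by it has all its coordinates
    killed by [f], and is 0. *)
Lemma free_flat (M N : lmodType R) (f : {linear M -> N}) :
  injective f -> injective (tensor_mapr (free R^c X) f).
Proof.
move=> fI; apply: additive_inj => z fz0.
have coordC x w : free_coord N x (tensor_mapr (free R^c X) f w) = f (free_coord M x w).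
  move: w; apply: (@tensor_ext _ _ _ _
    (free_coord N x \o tensor_mapr (free R^c X) f) (f \o free_coord M x)) => a m /=.
  by rewrite tensor_maprE !tensor_lift_tens linearZ.
have [A /(_ A (fsubset_refl A)) ->] := free_coord_sum z.
rewrite big1 // => x _; suff -> : free_coord M x z = 0 by rewrite tens0r.
by apply: fI; rewrite -coordC fz0 !raddf0.
Qed.
End FreeFlat.
End TensorExact.

(** * Long exact sequences of Tor and Ext *)

Section AugmentedResolution.
Variables (R : pzRingType) (M : lmodType R).

(** The augmentation shifts degrees by one: [Tor] and [Ext] of degree [n.+1] are homology at index
    [n.+2], while index 0 holds the functor [X (x) -] or [Hom(P, -)] itself. *)
Definition ares (n : nat) : lmodType R := if n is n'.+1 then res M n' else M.

Definition ares_diff (n : nat) : {linear ares n.+1 -> ares n} :=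
  if n is n'.+1 then res_diff M n' else free_eval M.

Lemma ares_exact n : exact_at (ares_diff n.+1) (ares_diff n).
Proof. by case: n => [|n]; [exact: res_exact0|exact: res_exact]. Qed.

Lemma ares_diff_diff n x : ares_diff n (ares_diff n.+1 x) = 0.
Proof. by apply/ares_exact; exists x. Qed.
End AugmentedResolution.

Section TorSequence.
Variables (R : pzRingType) (X : lmodType R^c) (M' M M'' : lmodType R).
Variables (f : {linear M' -> M}) (g : {linear M -> M''}) (fg : short_exact f g).

Let fI : injective f. Proof. by case: fg. Qed.
Let fgE : exact_at f g. Proof. by case: fg. Qed.
Let gS : forall z, exists y, g y = z. Proof. by case: fg. Qed.

Local Notation T n := (tensor_mapl _ (ares_diff X n)).
Local Notation F n := (tensor_mapr (ares X n) f).
Local Notation G n := (tensor_mapr (ares X n) g).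

Lemma Tor_trivialP (N : lmodType R) n : trivial_module (Tor n.+1 X N) <->
  acyclic_at (tensor_mapl N (ares_diff X n.+2)) (tensor_mapl N (ares_diff X n.+1)).
Proof. exact: homology_trivialP. Qed.

(** Indices start at 1, where the terms are free; [X], in index 0, need not be flat. *)
Let FI n : injective (F n.+1). Proof. exact: free_flat. Qed.
Let GS n : forall z, exists y, G n y = z. Proof. exact: tensor_mapr_surj. Qed.
Let FG n : exact_at (F n) (G n). Proof. exact: tensor_mapr_exact. Qed.
Let FT n x : F n (T n x) = T n (F n.+1 x). Proof. exact: tensor_mapC. Qed.
Let GT n x : G n (T n x) = T n (G n.+1 x). Proof. exact: tensor_mapC. Qed.
Let TT (N : lmodType R) n (x : tensor (ares X n.+2) N) : T n (T n.+1 x) = 0.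
Proof. by apply: tensor_mapl0 => y; apply: ares_diff_diff. Qed.
Let T0 (N : lmodType R) :
  acyclic_at (tensor_mapl N (ares_diff X 1)) (tensor_mapl N (ares_diff X 0)).
Proof.
move=> y.
exact: (iffLR (tensor_mapl_exact (M := N) (@ares_exact _ X 0) (@free_eval_surj _ X) y)).
Qed.

Lemma Tor_mid n : trivial_module (Tor n.+1 X M') -> trivial_module (Tor n.+1 X M'') ->
  trivial_module (Tor n.+1 X M).
Proof.
rewrite !Tor_trivialP.
exact: (ladder_mid (@FT n.+2) (@FT n.+1) (@GT n.+2) (@GT n.+1) (@TT _ n.+1)
  (@FG n.+2) (FI (n := n)) (@GS n.+3)).
Qed.

(** Two cases in one: for [n = 0] injectivity is a genuine assumption and acyclicity is right
    exactness ([T0]); for [n > 0] they are flatness and the vanishing of [Tor n X M']. *)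
Lemma Tor_right n : injective (F n) ->
  acyclic_at (tensor_mapl M' (ares_diff X n.+1)) (tensor_mapl M' (ares_diff X n)) ->
  trivial_module (Tor n.+1 X M) -> trivial_module (Tor n.+1 X M'').
Proof.
move=> Fn XM'; rewrite !Tor_trivialP => XM.
exact: (ladder_right (@FT n.+1) (@FT n) (@GT n.+2) (@GT n.+1) (@TT _ n)
  (@FG n.+2) (@FG n.+1) Fn (@GS n.+2) XM XM').
Qed.

Lemma Tor_left n : trivial_module (Tor n.+2 X M'') -> trivial_module (Tor n.+1 X M) ->
  trivial_module (Tor n.+1 X M').
Proof.
rewrite !Tor_trivialP.
exact: (ladder_left (@FT n.+2) (@FT n.+1) (@GT n.+3) (@GT n.+2) (@TT _ n.+2)
  (@FG n.+3) (@FG n.+2) (FI (n := n.+1)) (@GS n.+4)).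
Qed.

Lemma Tor1_right : injective (tensor_mapr X f) ->
  trivial_module (Tor 1 X M) -> trivial_module (Tor 1 X M'').
Proof. by move=> fXI; apply: (@Tor_right 0). Qed.

Lemma TorS_right n : trivial_module (Tor n.+1 X M') ->
  trivial_module (Tor n.+2 X M) -> trivial_module (Tor n.+2 X M'').
Proof. by move=> /Tor_trivialP; apply: Tor_right. Qed.

(** Exactness of [Tor 1 X M'' -> X (x) M' -> X (x) M]. An element killed by [f] lifts to some [y]
    over the free cover of [X]; the image of [y] under [f] bounds by right exactness, so [y] itself
    bounds. *)
Lemma Tor1_inj : trivial_module (Tor 1 X M'') -> injective (tensor_mapr X f).
Proof.
move=> /Tor_trivialP XM; apply: additive_inj => x.
have [y <-] := tensor_mapl_surj (M := M') (@free_eval_surj _ X) x.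
rewrite [LHS](@FT 0) => fy0; have [w wP] := T0 fy0.
have [y' <-] := ladder_connect (@FT 1) (@GT 2) (@GT 1) (@TT _ 1) (@FG 2) (@FG 1)
  (FI (n := 0)) (@GS 3) XM (esym wP).
exact: (@TT _ 0).
Qed.
End TorSequence.

(** * Factorizations and exactness of Hom *)

Section Factor.
Variables (R : pzRingType) (P M N : lmodType R).

(** Preimages chosen pointwise are unique because [f] is injective, which makes the choice
    linear. *)
Lemma factor_inj (f : {linear M -> N}) (h : {linear P -> N}) : injective f ->
  (forall p, exists m, f m = h p) -> exists k : {linear P -> M}, forall p, f (k p) = h p.
Proof.
move=> fI /choice[k kP].
have k_lin : linear k by move=> a p q; apply: fI; rewrite linearP !kP linearP.
pose K : {linear P -> M} := HB.pack k (GRing.isLinear.Build _ _ _ _ _ k_lin).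
by exists K.
Qed.

Lemma factor_surj (e : {linear P -> M}) (h : {linear P -> N}) :
  (forall m, exists p, e p = m) -> (forall p, e p = 0 -> h p = 0) ->
  exists k : {linear M -> N}, forall p, k (e p) = h p.
Proof.
move=> eS eh; have [s sP] := choice eS.
have kE p : h (s (e p)) = h p.
  apply/eqP; rewrite -subr_eq0 -raddfB; apply/eqP/eh.
  by rewrite raddfB /= sP subrr.
have k_lin : linear (fun m => h (s m)).
  move=> a m n; have [p <-] := eS m; have [q <-] := eS n.
  by rewrite -linearP !kE linearP.
pose K : {linear M -> N} :=
  HB.pack (fun m => h (s m)) (GRing.isLinear.Build _ _ _ _ _ k_lin).
by exists K.
Qed.
End Factor.

Section Postcomposition.
Variables (R : pzRingType) (P M N : lmodType R) (g : {linear M -> N}).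

Definition postcomp_fun (h : Lhom P M) : Lhom P N := g \o h.

Fact postcomp_is_zmod_morphism : zmod_morphism postcomp_fun.
Proof. by move=> h k; apply: LhomP => p /=; rewrite raddfB. Qed.
HB.instance Definition _ := GRing.isZmodMorphism.Build
  (Lhom P M) (Lhom P N) postcomp_fun postcomp_is_zmod_morphism.
Definition postcomp : {additive Lhom P M -> Lhom P N} := postcomp_fun.
End Postcomposition.

Lemma Lhom_eq (R : pzRingType) (P M : lmodType R) (h k : Lhom P M) :
  h = k -> forall x, (h : {linear P -> M}) x = (k : {linear P -> M}) x.
Proof. by move=> ->. Qed.

Section LhomExact.
Variables (R : pzRingType) (M' M M'' : lmodType R).
Variables (f : {linear M' -> M}) (g : {linear M -> M''}).

Lemma postcomp_inj (P : lmodType R) : injective f -> injective (postcomp P f).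
Proof.
by move=> fI h k /Lhom_eq hk; apply: LhomP => p; apply: fI; apply: hk.
Qed.

Lemma postcomp_exact (P : lmodType R) :
  injective f -> exact_at f g -> exact_at (postcomp P f) (postcomp P g).
Proof.
move=> fI fg h; split=> [/Lhom_eq gh|[k <-]]; last first.
  by apply: LhomP => p /=; apply/fg; exists ((k : {linear P -> M'}) p).
have [|k kP] := factor_inj (h := h) fI; last by exists k; apply: LhomP.
by move=> p; apply/fg; exact: gh.
Qed.

Lemma postcomp_surj (P : lmodType R) : projective P ->
  (forall z, exists y, g y = z) -> forall z, exists y, postcomp P g y = z.
Proof.
by move=> proj gS h; have [k kP] := proj _ _ g h gS; exists k; apply: LhomP.
Qed.

Lemma precomp_inj (N : lmodType R) :
  (forall z, exists y, g y = z) -> injective (precomp N g).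
Proof.
move=> gS h k /Lhom_eq hk; apply: LhomP => z; have [y <-] := gS z; exact: hk.
Qed.

Lemma precomp_acyclic (N : lmodType R) : exact_at f g ->
  (forall z, exists y, g y = z) -> acyclic_at (precomp N g) (precomp N f).
Proof.
move=> fg gS h /Lhom_eq hf.
have [|k kP] := factor_surj (h := h) gS; last by exists k; apply: LhomP.
by move=> p /fg[x <-]; exact: hf.
Qed.
End LhomExact.

Section ExtSequence.
Variables (R : pzRingType) (P : lmodType R) (M' M M'' : lmodType R).
Variables (f : {linear M' -> M}) (g : {linear M -> M''}) (fg : short_exact f g).

Let fI : injective f. Proof. by case: fg. Qed.
Let fgE : exact_at f g. Proof. by case: fg. Qed.
Let gS : forall z, exists y, g y = z. Proof. by case: fg. Qed.

Local Notation H n := (precomp _ (ares_diff P n)).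
Local Notation F n := (postcomp (ares P n) f).
Local Notation G n := (postcomp (ares P n) g).

Lemma Ext_trivialP (N : lmodType R) n : trivial_module (Ext n.+1 P N) <->
  acyclic_at (precomp N (ares_diff P n.+1)) (precomp N (ares_diff P n.+2)).
Proof. exact: homology_trivialP. Qed.

Let FI n : injective (F n). Proof. exact: postcomp_inj. Qed.
(** From index 1 on the terms are free, hence projective; [P], in index 0, need not be. *)
Let GS n : forall z, exists y, G n.+1 y = z.
Proof.
apply: postcomp_surj gS; exact: (@free_projective R (syzygy P n)).
Qed.
Let FG n : exact_at (F n) (G n). Proof. exact: postcomp_exact. Qed.
Let FH n x : F n.+1 (H n x) = H n (F n x). Proof. exact: LhomP. Qed.
Let GH n x : G n.+1 (H n x) = H n (G n x). Proof. exact: LhomP. Qed.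
Let HH (N : lmodType R) n (x : Lhom (ares P n) N) : H n.+1 (H n x) = 0.
Proof. by apply: LhomP => y /=; rewrite ares_diff_diff raddf0. Qed.
Let H0 (N : lmodType R) :
  acyclic_at (precomp N (ares_diff P 0)) (precomp N (ares_diff P 1)).
Proof. exact: precomp_acyclic (@ares_exact _ P 0) (@free_eval_surj _ P). Qed.

Lemma Ext_mid n : trivial_module (Ext n.+1 P M') -> trivial_module (Ext n.+1 P M'') ->
  trivial_module (Ext n.+1 P M).
Proof.
rewrite !Ext_trivialP.
exact: (ladder_mid (@FH n.+1) (@FH n.+2) (@GH n.+1) (@GH n.+2) (@HH _ n.+1)
  (@FG n.+2) (FI (n := n.+3)) (@GS n)).
Qed.

Lemma Ext_right n : trivial_module (Ext n.+1 P M) -> trivial_module (Ext n.+2 P M') ->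
  trivial_module (Ext n.+1 P M'').
Proof.
rewrite !Ext_trivialP.
exact: (ladder_right (@FH n.+2) (@FH n.+3) (@GH n.+1) (@GH n.+2) (@HH _ n.+2)
  (@FG n.+2) (@FG n.+3) (FI (n := n.+4)) (@GS n.+1)).
Qed.

(** For [n = 0] surjectivity is a genuine assumption and acyclicity is left exactness ([H0]); for
    [n > 0] they are projectivity and the vanishing of [Ext n P M'']. *)
Let Ext_left n : (forall z, exists y, G n y = z) ->
  acyclic_at (precomp M'' (ares_diff P n)) (precomp M'' (ares_diff P n.+1)) ->
  trivial_module (Ext n.+1 P M) -> trivial_module (Ext n.+1 P M').
Proof.
move=> Gn PM''; rewrite !Ext_trivialP.
exact: (ladder_left (@FH n.+1) (@FH n.+2) (@GH n) (@GH n.+1) (@HH _ n)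
  (@FG n.+1) (@FG n.+2) (FI (n := n.+2)) Gn PM'').
Qed.

Lemma ExtS_left n : trivial_module (Ext n.+1 P M'') ->
  trivial_module (Ext n.+2 P M) -> trivial_module (Ext n.+2 P M').
Proof. by move=> /Ext_trivialP; apply: Ext_left. Qed.

Lemma Ext1_left : (forall z, exists y, postcomp P g y = z) ->
  trivial_module (Ext 1 P M) -> trivial_module (Ext 1 P M').
Proof. by move=> gPS; apply: (@Ext_left 0). Qed.

(** Exactness of [Hom(P, M) -> Hom(P, M'') -> Ext 1 P M']. The pullback of [z] to the free cover of
    [P] lifts to a cocycle, which factors through [P]; precomposition with the augmentation is
    injective, so the equality descends. *)
Lemma Ext1_surj : trivial_module (Ext 1 P M') ->
  forall z, exists y, postcomp P g y = z.
Proof.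
move=> /Ext_trivialP PM' z.
have [|y yP] := ladder_lift (@FH 1) (@FH 2) (@GH 0) (@GH 1) (@HH _ 1)
  (@FG 1) (@FG 2) (FI (n := 3)) (@GS 0) (@H0 M) PM' (z := H 0 z).
  exact: (@HH _ 0).
by exists y; apply: (precomp_inj (@free_eval_surj _ P)).
Qed.
End ExtSequence.

(** * Faithfulness *)

Section LinearCokernel.
Variables (R : pzRingType) (U V : lmodType R) (f : {linear U -> V}).

Definition lcoker : Type := cokernel f.
HB.instance Definition _ := GRing.Zmodule.on lcoker.

Let proj (y : V) : lcoker := coker_proj f y.

Definition lcoker_scale (r : R) (z : lcoker) : lcoker :=
  proj (r *: repr (z : cokernel f)).

(** Independence of the representative: the image of [f] is stable under scaling. *)
Lemma lcoker_scaleE r y : lcoker_scale r (proj y) = proj (r *: y).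
Proof.
apply/eqP; rewrite -subr_eq0 -[_ - _]raddfB -scalerBr; apply/eqP/coker_proj_eq0.
have [|x xP] := (coker_proj_eq0 f (repr (proj y : cokernel f) - y)).1.
  by rewrite raddfB /= {1}/coker_proj reprK subrr.
by exists (r *: x); rewrite -xP [LHS]linearZ.
Qed.

Fact lcoker_scaleA r t z : lcoker_scale r (lcoker_scale t z) = lcoker_scale (r * t) z.
Proof. by have [y <-] := coker_proj_surj z; rewrite (lcoker_scaleE t) !lcoker_scaleE scalerA. Qed.
Fact lcoker_scale1 : left_id 1 lcoker_scale.
Proof. by move=> z; have [y <-] := coker_proj_surj z; rewrite lcoker_scaleE scale1r. Qed.
Fact lcoker_scaleDr : right_distributive lcoker_scale +%R.
Proof.
move=> r z w; have [y <-] := coker_proj_surj z; have [x <-] := coker_proj_surj w.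
by rewrite -[_ + _]raddfD !lcoker_scaleE scalerDr [LHS]raddfD.
Qed.
Fact lcoker_scaleDl z : {morph lcoker_scale^~ z : r t / r + t}.
Proof.
move=> r t; have [y <-] := coker_proj_surj z.
by rewrite !lcoker_scaleE scalerDl [LHS]raddfD.
Qed.
HB.instance Definition _ := GRing.Zmodule_isLmodule.Build R lcoker
  lcoker_scaleA lcoker_scale1 lcoker_scaleDr lcoker_scaleDl.

Fact lcoker_proj_is_linear : linear proj.
Proof.
move=> r y z; rewrite [LHS]raddfD; congr (_ + _).
exact/esym/lcoker_scaleE.
Qed.
HB.instance Definition _ :=
  GRing.isLinear.Build R V lcoker *:%R proj lcoker_proj_is_linear.
Definition lcoker_proj : {linear V -> lcoker} := proj.
End LinearCokernel.

(* The right R-module Hom_Z(K, K), with (psi r)(k) = psi (r k). *)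
Section AdditiveEnd.
Variables (R : pzRingType) (K : lmodType R).

Definition zend : Type := Lhom (zmodule K) (zmodule K).
HB.instance Definition _ := GRing.Zmodule.on zend.

Definition zend_mul (r : R) (k : zmodule K) : zmodule K := r *: (k : K).
Fact zend_mul_is_linear r : linear (zend_mul r).
Proof.
move=> n k l; rewrite /zend_mul [LHS]scalerDr; congr (_ + _).
exact: (esym (scalerMzr r (k : K) n)).
Qed.
HB.instance Definition _ r :=
  GRing.isLinear.Build int (zmodule K) (zmodule K) *:%R (zend_mul r) (zend_mul_is_linear r).

Definition zend_scale (r : R^c) (psi : zend) : zend :=
  (psi : {linear zmodule K -> zmodule K}) \o zend_mul r.

Fact zend_scaleA r t psi : zend_scale r (zend_scale t psi) = zend_scale (r * t) psi.
Proof. by apply: LhomP => k /=; rewrite /zend_mul scalerA. Qed.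
Fact zend_scale1 : left_id 1 zend_scale.
Proof. by move=> psi; apply: LhomP => k /=; rewrite /zend_mul scale1r. Qed.
Fact zend_scaleDr : right_distributive zend_scale +%R.
Proof. by move=> r psi phi; apply: LhomP. Qed.
Fact zend_scaleDl psi : {morph zend_scale^~ psi : r t / r + t}.
Proof.
by move=> r t; apply: LhomP => k /=; rewrite /zend_mul scalerDl -[RHS]raddfD.
Qed.
HB.instance Definition _ := GRing.Zmodule_isLmodule.Build R^c zend
  zend_scaleA zend_scale1 zend_scaleDr zend_scaleDl.
End AdditiveEnd.

Section Faithful.
Variables (R : pzRingType) (X : lmodType R^c).
Hypothesis X_faithful :
  forall M : lmodType R^c, trivial_module (Lhom X M) -> trivial_module M.

(* By adjunction Hom(X, Hom_Z(K, K)) = Hom_Z(X (x) K, K) = 0, so that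
   Hom_Z(K, K) = 0 and the identity of K vanishes. *)
Lemma tensor_faithful (K : lmodType R) :
  trivial_module (tensor X K) -> trivial_module K.
Proof.
move=> XK0; suff E0 : trivial_module (zend K).
  move=> k; exact: (Lhom_eq (E0 (idfun : {linear zmodule K -> zmodule K})) k).
apply: X_faithful => phi; apply: LhomP => x; apply: LhomP => k.
(* The balanced map adjoint to [phi]; it factors through [X (x) K], which is 0. *)
pose h (x : X) (k : K) : K :=
  ((phi : {linear X -> zend K}) x : {linear zmodule K -> zmodule K}) k.
have hbal : balanced h.
  split=> [y z l|y l m|y r l]; rewrite /h; first by rewrite raddfD.
    exact: raddfD.
  by rewrite linearZ.
transitivity (tensor_lift hbal (tens x (k : K))); last by rewrite [tens _ _]XK0 raddf0.
exact/esym/(tensor_lift_tens hbal).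
Qed.

(** For [K] the cokernel of [f], every element of [X (x) K] comes from [X (x) V], hence from
    [X (x) U], and so is 0; by faithfulness [K] is 0. *)
Lemma tensor_reflect_surj (U V : lmodType R) (f : {linear U -> V}) :
  (forall z, exists y, tensor_mapr X f y = z) -> forall z, exists y, f y = z.
Proof.
move=> XfS z; apply/coker_proj_eq0.
suff K0 : trivial_module (lcoker f) by exact: (K0 (lcoker_proj f z)).
apply: tensor_faithful => w.
have [v <-] := tensor_mapr_surj (g := lcoker_proj f) (@coker_proj_surj _ _ f) w.
have [u <-] := XfS v; move: u.
apply: (@tensor_ext _ _ _ _ (tensor_mapr X (lcoker_proj f) \o tensor_mapr X f) \0).
move=> x u /=; rewrite !tensor_maprE.
have -> : lcoker_proj f (f u) = 0 by apply/coker_proj_eq0; exists u.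
exact: tens0r.
Qed.
End Faithful.

(** * Auslander and Bass classes *)

Section BimoduleFunctors.
Variables (S R : pzRingType) (C : bimodType S R).

Section BtensorMap.
Variables (M N : lmodType R) (g : {linear M -> N}).

(** The function is [tensor_mapr], retyped to speak of [S]-linearity; its exactness properties carry
    over by conversion. *)
Definition btensor_map_fun (z : btensor C M) : btensor C N := tensor_mapr (rmod C) g z.

Fact btensor_map_is_linear : linear btensor_map_fun.
Proof.
move=> s y z; rewrite /btensor_map_fun [LHS]raddfD; congr (_ + _); move: y.
apply: (@tensor_ext _ _ _ _ (tensor_mapr (rmod C) g \o btensor_scale C M s)
  (btensor_scale C N s \o tensor_mapr (rmod C) g)) => c m /=.
rewrite btensor_scaleE (tensor_maprE g (c : rmod C) m) [RHS]btensor_scaleE.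
exact: (tensor_maprE g (s *: (c : C) : rmod C) m).
Qed.
HB.instance Definition _ := GRing.isLinear.Build S (btensor C M) (btensor C N)
  *:%R btensor_map_fun btensor_map_is_linear.
Definition btensor_map : {linear btensor C M -> btensor C N} := btensor_map_fun.
End BtensorMap.

Section BhomMap.
Variables (M N : lmodType S) (g : {linear M -> N}).

Definition bhom_map_fun (h : bhom C M) : bhom C N := postcomp C g h.

Fact bhom_map_is_linear : linear bhom_map_fun.
Proof. by move=> r h k; apply: LhomP => c /=; rewrite raddfD. Qed.
HB.instance Definition _ := GRing.isLinear.Build R (bhom C M) (bhom C N)
  *:%R bhom_map_fun bhom_map_is_linear.
Definition bhom_map : {linear bhom C M -> bhom C N} := bhom_map_fun.
End BhomMap.

Lemma mu_natural (M N : lmodType R) (g : {linear M -> N}) (m : M) :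
  postcomp C (btensor_map g) (mu C M m) = mu C N (g m).
Proof. by apply: LhomP => c /=; exact: tensor_maprE. Qed.

Lemma nu_natural (M N : lmodType S) (g : {linear M -> N}) (z : btensor C (bhom C M)) :
  nu C N (tensor_mapr (rmod C) (bhom_map g) z) = g (nu C M z).
Proof.
move: z; apply: (@tensor_ext _ _ _ _
  (nu C N \o tensor_mapr (rmod C) (bhom_map g)) (g \o nu C M)) => c h /=.
by rewrite tensor_maprE [LHS]nuE [X in g X]nuE.
Qed.

Lemma btensor_short_exact (M' M M'' : lmodType R)
    (f : {linear M' -> M}) (g : {linear M -> M''}) :
  short_exact f g -> injective (tensor_mapr (rmod C) f) ->
  short_exact (btensor_map f) (btensor_map g).
Proof.
move=> [_ fg gS] fI; split=> //; first exact: tensor_mapr_exact.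
exact: tensor_mapr_surj.
Qed.

Lemma bhom_short_exact (M' M M'' : lmodType S)
    (f : {linear M' -> M}) (g : {linear M -> M''}) :
  short_exact f g -> (forall z, exists y, postcomp C g y = z) ->
  short_exact (bhom_map f) (bhom_map g).
Proof.
move=> [fI fg _] gS; split=> //; first exact: postcomp_inj.
exact: postcomp_exact.
Qed.
End BimoduleFunctors.

(** * Two of three for the Auslander class *)

Section AuslanderThree.
Variables (S R : pzRingType) (C : bimodType S R) (M' M M'' : lmodType R).
Variables (f : {linear M' -> M}) (g : {linear M -> M''}) (fg : short_exact f g).

Let fI : injective f. Proof. by case: fg. Qed.
Let fgE : exact_at f g. Proof. by case: fg. Qed.
Let gS : forall z, exists y, g y = z. Proof. by case: fg. Qed.

Let fC := btensor_map C f.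
Let gC := btensor_map C g.
Let fCmu x : postcomp C fC (mu C M' x) = mu C M (f x). Proof. exact: mu_natural. Qed.
Let gCmu y : postcomp C gC (mu C M y) = mu C M'' (g y). Proof. exact: mu_natural. Qed.

Lemma Auslander_mid : Auslander C M' -> Auslander C M'' -> Auslander C M.
Proof.
move=> [T' E' mu'] [T'' E'' mu''].
(* The vanishing of [Tor 1] at [M''] keeps the sequence exact after tensoring with [C]. *)
have fgC : short_exact fC gC := btensor_short_exact fg (Tor1_inj fg (T'' 1 isT)).
have [fCI fgCE _] := fgC.
split=> [[//|i] _|[//|i] _|].
- exact: (Tor_mid fg (T' _ _) (T'' _ _)).
- exact: (Ext_mid fgC (E' _ _) (E'' _ _)).
- exact: (five_mid fgE gS (postcomp_inj fCI) (postcomp_exact fCI fgCE) fCmu gCmu).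
Qed.

Lemma Auslander_left : Auslander C M -> Auslander C M'' -> Auslander C M'.
Proof.
move=> [T E muM] [T'' E'' mu''].
have fgC : short_exact fC gC := btensor_short_exact fg (Tor1_inj fg (T'' 1 isT)).
have [fCI fgCE _] := fgC.
split=> [[//|i] _|[//|[|i]] _|].
- exact: (Tor_left fg (T'' _ _) (T _ _)).
(* Degree 1 needs [Hom(C, C (x) g)] to be onto: up to [mu] it is the surjection [g]. *)
- apply: (Ext1_left fgC) (E 1 isT) => h.
  have [z <-] := bijective_surj mu'' h; have [y <-] := gS z.
  by exists (mu C M y).
- exact: (ExtS_left fgC (E'' _ _) (E _ _)).
- exact: (five_left fI fgE (postcomp_inj fCI) (postcomp_exact fCI fgCE) fCmu gCmu).
Qed.

(* [Hom_S(C, ker(C (x) f))] is the kernel of [Hom_S(C, C (x) f)], which is [f]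
   up to [mu]; hence it vanishes and faithfulness makes [C (x) f] injective. *)
Lemma Auslander_right :
  (forall N : lmodType S, trivial_module (Lhom C N) -> trivial_module N) ->
  Auslander C M' -> Auslander C M -> Auslander C M''.
Proof.
move=> CS [T' E' mu'] [T E muM].
have fCI : injective fC.
  apply: additive_inj => x /eqP x0.
  suff K0 : trivial_module (kernel fC) by exact: (congr1 val (K0 (Kernel x0))).
  apply: CS => h.
  pose k : {linear kernel fC -> btensor C M'} := val.
  apply: (postcomp_inj (f := k)); first exact: val_inj.
  (* The inclusion of the kernel composed with [h] is [mu m'] for some [m']; by naturality
     [mu (f m') = 0], whence [m' = 0]. *)
  have [m' m'P] := bijective_surj mu' (postcomp C k h).
  have m'0 : m' = 0.
    apply: fI; apply: (bij_inj muM); rewrite -fCmu m'P !raddf0.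
    by apply: LhomP => c; exact: (eqP (kernel_valP ((h : {linear C -> kernel fC}) c))).
  by rewrite -m'P m'0 !raddf0.
have fgC : short_exact fC gC := btensor_short_exact fg fCI.
have [_ fgCE _] := fgC.
split=> [[//|[|i]] _|[//|i] _|].
- exact: (Tor1_right fg fCI (T 1 isT)).
- exact: (TorS_right fg (T' _ _) (T _ _)).
- exact: (Ext_right fgC (E _ _) (E' _ _)).
- exact: (five_right fgE gS (postcomp_exact fCI fgCE) (Ext1_surj fgC (E' 1 isT)) fCmu gCmu).
Qed.
End AuslanderThree.

(** * Two of three for the Bass class *)

Section BassThree.
Variables (S R : pzRingType) (C : bimodType S R) (N' N N'' : lmodType S).
Variables (f : {linear N' -> N}) (g : {linear N -> N''}) (fg : short_exact f g).

Let fI : injective f. Proof. by case: fg. Qed.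
Let fgE : exact_at f g. Proof. by case: fg. Qed.
Let gS : forall z, exists y, g y = z. Proof. by case: fg. Qed.

Let fH := bhom_map C f.
Let gH := bhom_map C g.
Let TfH := btensor_map C fH.
Let TgH := btensor_map C gH.
Let fnu x : f (nu C N' x) = nu C N (TfH x). Proof. exact/esym/nu_natural. Qed.
Let gnu y : g (nu C N y) = nu C N'' (TgH y). Proof. exact/esym/nu_natural. Qed.

(** The vanishing of [Ext 1] at [N'] makes [Hom(C, -)] exact on the sequence, and the vanishing of
    [Tor 1] at [Hom(C, N'')] then makes [C (x) -] exact on the result. *)
Lemma Bass_mid : Bass C N' -> Bass C N'' -> Bass C N.
Proof.
move=> [E' T' nu'] [E'' T'' nu''].
have fgH : short_exact fH gH := bhom_short_exact fg (Ext1_surj fg (E' 1 isT)).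
have [_ TfgE TgS] := btensor_short_exact fgH (Tor1_inj fgH (T'' 1 isT)).
split=> [[//|i] _|[//|i] _|].
- exact: (Ext_mid fg (E' _ _) (E'' _ _)).
- exact: (Tor_mid fgH (T' _ _) (T'' _ _)).
- exact: (five_mid TfgE TgS fI fgE fnu gnu).
Qed.

Lemma Bass_right : Bass C N' -> Bass C N -> Bass C N''.
Proof.
move=> [E' T' nu'] [E T nuN].
have fgH : short_exact fH gH := bhom_short_exact fg (Ext1_surj fg (E' 1 isT)).
(* [Tor 1] at [Hom(C, N'')] is not yet known to vanish, so injectivity is read off from [nu]: up to
   [nu] this map is [f]. *)
have TfI : injective TfH.
  move=> x y xy; apply: (bij_inj nu'); apply: fI.
  by rewrite !fnu xy.
have [_ TfgE TgS] := btensor_short_exact fgH TfI.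
split=> [[//|i] _|[//|[|i]] _|].
- exact: (Ext_right fg (E _ _) (E' _ _)).
- exact: (Tor1_right fgH TfI (T 1 isT)).
- exact: (TorS_right fgH (T' _ _) (T _ _)).
- exact: (five_right TfgE TgS fgE gS fnu gnu).
Qed.

(* [C (x) Hom_S(C, g)] is [g] up to [nu], hence surjective; faithfulness then
   gives the surjectivity of [Hom_S(C, g)]. *)
Lemma Bass_left :
  (forall M : lmodType R^c, trivial_module (Lhom (rmod C) M) -> trivial_module M) ->
  Bass C N -> Bass C N'' -> Bass C N'.
Proof.
move=> CR [E T nuN] [E'' T'' nu''].
have gHS : forall z, exists y, gH y = z.
  apply: (tensor_reflect_surj CR) => z.
  have [y yP] := gS (nu C N'' z); have [x xP] := bijective_surj nuN y.
  by exists x; apply: (bij_inj nu''); rewrite -gnu xP.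
have fgH : short_exact fH gH := bhom_short_exact fg gHS.
have [TfI TfgE TgS] := btensor_short_exact fgH (Tor1_inj fgH (T'' 1 isT)).
split=> [[//|[|i]] _|[//|i] _|].
(* In degree 1 the surjectivity of [Hom(C, g)] takes the place of a vanishing [Ext] group of
   [N'']. *)
- exact: (Ext1_left fg gHS (E 1 isT)).
- exact: (ExtS_left fg (E'' _ _) (E _ _)).
- exact: (Tor_left fgH (T'' _ _) (T _ _)).
- exact: (five_left TfI TfgE fI fgE fnu gnu).
Qed.
End BassThree.

Theorem corollary6p7 (R S : pzRingType) (C : bimodType S R) :
  faithfully_semidualizing C ->
  two_of_three (Auslander C) /\ two_of_three (Bass C).
Proof.
move=> [_ CS CR]; split=> M' M M'' f g fg; split.
- exact: Auslander_right fg CS.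
- exact: Auslander_mid fg.
- exact: Auslander_left fg.
- exact: Bass_right fg.
- exact: Bass_mid fg.
- exact: Bass_left fg CR.
Qed.
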